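(* Let $N\ge 1$ and let $f:[0,1]\to\mathbb{R}$ be continuous and strictly increasing, with $f\in C^1(0,1)$ and $f'$ positive on $(0,1)$. Let $F:T\Delta_N^\circ\to\mathbb{R}_{\ge 0}$ be the Finsler function $F(v)=\max_i f'(p_i)v_i$ for $v\in T_P\Delta_N^\circ$, and let $D_F$ be the associated Finsler quasidistance on $\Delta_N^\circ$. Then $D_f(P,Q)=D_F(P,Q)$ for all $P,Q\in\Delta_N^\circ$.
   Context: $\Delta_N=\{P=(p_0,\dots,p_N)\in[0,1]^{N+1} : \sum_i p_i=1\}$ is the $N$-dimensional probability simplex in $\mathbb{R}^{N+1}$, and $\Delta_N^\circ$ is its (relative) interior, i.e. the points with all $p_i>0$. For a continuous strictly increasing $f:[0,1]\to\mathbb{R}$ one sets $D_f(P,Q)=\max_{0\le i\le N}\big(f(q_i)-f(p_i)\big)$. (Without loss of generality $f$ may be rescaled affinely so that $f(0)=0$, $f(1)=1$.) For $P\in\Delta_N^\circ$ the tangent space is identified with $T_P\Delta_N^\circ=\{v=(v_0,\dots,v_N)\in\mathbb{R}^{N+1} : \sum_i v_i=0\}$, and $v_i$ denotes the $i$-th Cartesian component. A curve $\gamma:[a,b]\to\Delta_N^\circ$ is piecewise $C^1$ if it is continuous and $[a,b]$ can be cut into finitely many closed subintervals on each of which $\gamma$ is $C^1$. Its Finsler length is $L_F(\gamma)=\int_a^b F(\dot\gamma(\tau))\,d\tau$, where $\dot\gamma(\tau)\in T_{\gamma(\tau)}\Delta_N^\circ$. The Finsler quasidistance is $D_F(P,Q)=\inf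 L_F(\gamma)$, the infimum running over all piecewise $C^1$ curves $\gamma$ in $\Delta_N^\circ$ going from $P$ to $Q$. *)

(* Defs.v *)
From HB Require Import structures.
From mathcomp Require Import all_boot all_order all_algebra.
From mathcomp Require Import all_classical all_reals all_analysis.
Set Implicit Arguments.
Unset Strict Implicit.
Unset Printing Implicit Defensive.
Import Order.TTheory GRing.Theory Num.Theory.
Import numFieldNormedType.Exports.
Local Open Scope classical_set_scope.
Local Open Scope ring_scope.

Definition simplex (R : realType) (N : nat) : set 'rV[R]_N.+1 :=
  [set p : 'rV[R]_N.+1 | (forall i, 0 <= p 0 i <= 1) /\ \sum_i p 0 i = 1].

Definition simplex_int (R : realType) (N : nat) : set 'rV[R]_N.+1 :=
  [set p : 'rV[R]_N.+1 | simplex p /\ forall i, 0 < p 0 i].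

(* The neutral element of the big operator is itself one of the terms, so this
   is the maximum of the family whatever the signs of its members. *)
Definition max_family (R : realType) (N : nat) (u : 'I_N.+1 -> R) : R :=
  \big[Num.max/u ord0]_(i < N.+1) u i.

(* f is a total function, of which only the values on [0, 1] are used. *)
Definition D_f (R : realType) (N : nat) (f : R -> R) (P Q : 'rV[R]_N.+1) : R :=
  max_family (fun i => f (Q 0 i) - f (P 0 i)).

(* v is regarded as a tangent vector at p; the value is only meaningful for
   p in simplex_int and v with zero coordinate sum. *)
Definition F_f (R : realType) (N : nat) (f : R -> R) (p v : 'rV[R]_N.+1) : R :=
  max_family (fun i => f^`()%classic (p 0 i) * v 0 i).

(* C^1 on the closed interval [c, d]: the derivative g is relative to [c, d],
   hence one-sided at c and d, so that the values of gamma outside [c, d] are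
   irrelevant. *)
Definition C1_on (R : realType) (N : nat) (c d : R)
    (gamma : R -> 'rV[R]_N.+1) : Prop :=
  exists g : R -> 'rV[R]_N.+1,
    {within `[c, d], continuous g} /\
    forall t, t \in `[c, d] ->
      (s - t)^-1 *: (gamma s - gamma t) @[s --> within `[c, d] t^'] --> g t.

Definition piecewise_C1 (R : realType) (N : nat) (a b : R)
    (gamma : R -> 'rV[R]_N.+1) : Prop :=
  {within `[a, b], continuous gamma} /\
  exists2 s : seq R, itv_partition a b s &
    forall k, (k < size s)%N ->
      C1_on (nth b (a :: s) k) (nth b (a :: s) k.+1) gamma.

Definition curve_from_to (R : realType) (N : nat) (P Q : 'rV[R]_N.+1)
    (a b : R) (gamma : R -> 'rV[R]_N.+1) : Prop :=
  [/\ a < b, piecewise_C1 a b gamma,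
      forall t, t \in `[a, b] -> simplex_int (gamma t),
      gamma a = P & gamma b = Q].

(* For a piecewise C^1 curve, the two-sided derivative gamma^`() exists at all
   points of [a, b] but finitely many, which do not affect the integral. *)
Definition finsler_length (R : realType) (N : nat)
    (F : 'rV[R]_N.+1 -> 'rV[R]_N.+1 -> R) (a b : R)
    (gamma : R -> 'rV[R]_N.+1) : \bar R :=
  (\int[lebesgue_measure]_(t in `[a, b]) (F (gamma t) (gamma^`()%classic t))%:E)%E.

Definition finsler_dist (R : realType) (N : nat)
    (F : 'rV[R]_N.+1 -> 'rV[R]_N.+1 -> R) (P Q : 'rV[R]_N.+1) : \bar R :=
  ereal_inf [set l | exists (a b : R) (gamma : R -> 'rV[R]_N.+1),
    curve_from_to P Q a b gamma /\ l = finsler_length F a b gamma].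

(* Main.v *)
(* Lower bound: along a curve, F dominates each d/dt f(gamma_i), so the length
   dominates each f(q_i) - f(p_i) by the fundamental theorem of calculus on the
   C^1 pieces.
   Upper bound: the infimum is attained by a curve on [0, 1] along which every
   f(gamma_i) with p_i <= q_i is affine in t, while all the coordinates with
   q_i < p_i move down their segment with one common parameter G(t), chosen to
   keep the sum equal to 1. The decreasing coordinates contribute nonpositive
   terms to F, so F is constantly D_f(P, Q). *)
Require Import Defs.
From HB Require Import structures.
From mathcomp Require Import all_boot all_order all_algebra.
From mathcomp Require Import all_classical all_reals all_analysis.
From mathcomp Require Import measurable_realfun.
Set Implicit Arguments.
Unset Strict Implicit.
Unset Printing Implicit Defensive.
Import Order.TTheory GRing.Theory Num.Theory.
Import numFieldNormedType.Exports.
Local Open Scope classical_set_scope.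
Local Open Scope ring_scope.

(** * Maxima of finite families, and coordinates of interior points *)

Lemma le_max_family (R : realType) (N : nat) (u : 'I_N.+1 -> R) i :
  u i <= max_family u.
Proof. exact: le_bigmax. Qed.

Lemma max_family_le (R : realType) (N : nat) (u : 'I_N.+1 -> R) m :
  (forall i, u i <= m) -> max_family u <= m.
Proof. by move=> um; apply: bigmax_le. Qed.

Lemma max_family_ex (R : realType) (N : nat) (u : 'I_N.+1 -> R) :
  exists i, max_family u = u i.
Proof.
rewrite /max_family; elim/big_rec: _ => [|i m _ [j ->]]; first by exists ord0.
by case: (leP (u i) (u j)) => _; [exists j|exists i].
Qed.

(** The binary maximum is continuous, so induction on the list of indices applies. The neutral
    element [u ord0] varies along the filter too, which is why the empty list already uses the
    hypothesis. *)
Lemma cvg_max_family (R : realType) (N : nat) (T : Type) (G : set_system T)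
    (FG : Filter G) (u : 'I_N.+1 -> T -> R) (l : 'I_N.+1 -> R) :
  (forall i, u i x @[x --> G] --> l i) ->
  max_family (u ^~ x) @[x --> G] --> max_family l.
Proof.
move=> ul; rewrite /max_family; elim: (index_enum _) => [|i s IH].
  by under eq_fun do rewrite big_nil; rewrite big_nil; exact: ul.
under eq_fun do rewrite big_cons; rewrite big_cons.
have cmax : continuous (fun x : R * R => Num.max x.1 x.2).
  move=> x; apply: (@continuous_max R _ fst snd); [exact: cvg_fst|exact: cvg_snd].
exact: (cvg_comp2 (ul i) IH (cmax (_, _))).
Qed.

(** Since [N >= 1] there is a second coordinate, and its positivity keeps the [i]-th one strictly
    below the unit sum. *)
Lemma simplex_int_itv (R : realType) (N : nat) (p : 'rV[R]_N.+1) i :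
  (1 <= N)%N -> simplex_int p -> p 0 i \in `]0, 1[.
Proof.
case: N p i => // N p i _ [[_ sp] p0].
suff lt1 : p 0 i < \sum_j p 0 j by rewrite in_itv/= p0/= -[ltRHS]sp.
rewrite (bigD1 i)//= ltrDl.
have ji : lift i ord0 != i by rewrite eq_sym neq_lift.
rewrite (bigD1 (lift i ord0))//= ltr_pwDl// sumr_ge0// => j _.
exact/ltW.
Qed.

(** * Derivatives of curves: coordinatewise, and relative versus two-sided *)

Lemma is_derive_coord (R : realType) (n : nat) (gamma : R -> 'rV[R]_n)
    (t : R) (v : 'rV[R]_n) i :
  is_derive t 1 gamma v -> is_derive t 1 (fun s => gamma s 0 i) (v 0 i).
Proof.
move=> [dg <-]; apply: DeriveDef; first by move/derivable_mxP : dg; exact.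
by rewrite derive_mx// mxE.
Qed.

Lemma is_derive_row (R : realType) (n : nat) (gamma : R -> 'rV[R]_n)
    (t : R) (v : 'rV[R]_n) :
  (forall i, is_derive t 1 (fun s => gamma s 0 i) (v 0 i)) ->
  is_derive t 1 gamma v.
Proof.
move=> dg; have D : derivable gamma t 1.
  by apply/derivable_mxP => i j; rewrite ord1; case: (dg j).
apply: DeriveDef => //; rewrite derive_mx//.
by apply/rowP => i; rewrite mxE; case: (dg i).
Qed.

(** Around an interior point the interval is a neighbourhood, so the relative limit is a two-sided
    one after the substitution [s = h + t]. *)
Lemma C1_on_is_derive (R : realType) (n : nat) (gamma : R -> 'rV[R]_n.+1)
    (c d t : R) (v : 'rV[R]_n.+1) : t \in `]c, d[ ->
  (s - t)^-1 *: (gamma s - gamma t) @[s --> within `[c, d] t^'] --> v ->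
  is_derive t 1 gamma v.
Proof.
move=> tcd gv; suff H : h^-1 *: (gamma (h *: 1 + t) - gamma t) @[h --> 0^'] --> v.
  by apply: DeriveDef; [apply/cvg_ex; exists v|exact/cvg_lim].
apply/cvgrPdist_lt => e e0.
have : nbhs t (fun s => s != t -> s \in `[c, d] ->
    `|v - (s - t)^-1 *: (gamma s - gamma t)| < e).
  exact: (cvgrPdist_lt _ _).1 gv _ e0.
move=> /nbhs_ballP[r /= r0 rP].
have /nbhs_ballP[r' /= r'0 r'P] := near_in_itvoo tcd.
near=> h.
have hr : `|h| < Num.min r r'.
  by near: h; apply: dnbhs0_lt; rewrite lt_min r0.
have h0 : h != 0 by near: h; exact: nbhs_dnbhs_neq.
move: hr; rewrite lt_min => /andP[hr hr'].
have h1 : h *: (1 : R) = h := mulr1 h.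
have := rP (h + t); rewrite addrK h1; apply.
- by rewrite /ball/= opprD addrCA subrr addr0 normrN.
- by rewrite -subr_eq0 addrK.
- apply/subset_itv_oo_cc/r'P.
  by rewrite /ball/= opprD addrCA subrr addr0 normrN.
Unshelve. all: by end_near. Qed.

(** A limit survives restriction to any set [A]; what remains is the substitution [h = s - t]. *)
Lemma is_derive_C1 (R : realType) (n : nat) (gamma : R -> 'rV[R]_n.+1)
    (t : R) (A : set R) (v : 'rV[R]_n.+1) : 
  is_derive t 1 gamma v ->
  (s - t)^-1 *: (gamma s - gamma t) @[s --> within A t^'] --> v.
Proof.
move=> [dg <-]; apply: cvg_within_filter.
apply/cvgrPdist_lt => e e0.
have : nbhs (0 : R) (fun h => h != 0 ->
    `|'D_1 gamma t - h^-1 *: (gamma (h *: 1 + t) - gamma t)| < e).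
  exact: (cvgrPdist_lt _ _).1 dg _ e0.
move=> /nbhs_ballP[r /= r0 rP].
apply/nbhs_ballP; exists r => // s /=; rewrite /ball/= => st s0.
have h1 : (s - t) *: (1 : R) = s - t := mulr1 _.
have := rP (s - t); rewrite /ball/= h1 subrK; apply; last by rewrite subr_eq0.
by rewrite sub0r normrN distrC.
Qed.

(** * Lower bound: every curve is at least as long as [D_f] *)

Lemma within_continuous_coord (R : realType) (n : nat) (A : set R)
    (gamma : R -> 'rV[R]_n.+1) i :
  {within A, continuous gamma} -> {within A, continuous (fun t => gamma t 0 i)}.
Proof.
move=> /subspace_continuousP cg; apply/subspace_continuousP => t At.
exact: (cvg_comp _ _ (cg t At) (@coord_continuous R _ _ 0 i (gamma t))).
Qed.

Lemma within_continuous_F_f (R : realType) (N : nat) (f : R -> R) (A : set R)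
    (gamma v : R -> 'rV[R]_N.+1) :
  (forall x, x \in `]0, 1[ -> {for x, continuous f^`()%classic}) ->
  (forall t i, A t -> gamma t 0 i \in `]0, 1[) ->
  {within A, continuous gamma} -> {within A, continuous v} ->
  {within A, continuous (fun t => F_f f (gamma t) (v t))}.
Proof.
move=> f'_cont gA cg cv; apply/subspace_continuousP => t At.
apply: (@cvg_max_family R N _ _ _
  (fun i s => f^`()%classic (gamma s 0 i) * v s 0 i)) => i.
have /subspace_continuousP/(_ t At) cgi := within_continuous_coord (i := i) cg.
have /subspace_continuousP/(_ t At) cvi := within_continuous_coord (i := i) cv.
apply: cvgM cvi.
exact: (cvg_comp _ _ cgi (f'_cont _ (gA t i At))).
Qed.

Lemma derive1_is_derive (R : realType) (V : normedModType R) (gamma : R -> V)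
  (t : R) v : is_derive t 1 gamma v -> gamma^`()%classic t = v.
Proof. by move=> dg; rewrite derive1E derive_val. Qed.

(** The [i]-th term of the maximum defining [F_f] is the derivative of [f] along the [i]-th
    coordinate, so it integrates to the increment of [f]. Measurability is part of the conclusion
    because gluing the pieces relies on it. *)
Lemma C1_on_length_ge (R : realType) (N : nat) (f : R -> R) (c d : R)
    (gamma : R -> 'rV[R]_N.+1) i :
  (forall x, x \in `]0, 1[ -> derivable f x 1) ->
  (forall x, x \in `]0, 1[ -> {for x, continuous f^`()%classic}) ->
  c < d -> C1_on c d gamma -> {within `[c, d], continuous gamma} ->
  (forall t i, t \in `[c, d] -> gamma t 0 i \in `]0, 1[) ->
  measurable_fun `[c, d] (fun t => F_f f (gamma t) (gamma^`()%classic t)) /\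
  ((f (gamma d 0 i) - f (gamma c 0 i))%:E <=
    finsler_length (F_f f) c d gamma)%E.
Proof.
move=> df cf cd [g [cg gE]] cgam gam01.
have dgam t : t \in `]c, d[ -> is_derive t 1 gamma (g t).
  by move=> tcd; apply: (C1_on_is_derive tcd); apply: gE; exact: subset_itv_oo_cc.
(* The length involves the two-sided derivative, which is under control only on the open interval.
   There [h] equals [k], which is continuous up to the endpoints; the endpoints have measure zero,
   so [k] can replace [h] in the integral. *)
set h := (X in measurable_fun _ X); pose k t := F_f f (gamma t) (g t).
have hk : {in `]c, d[, h =1 k}.
  by move=> t tcd; rewrite /h (derive1_is_derive (dgam t tcd)).
have ck : {within `[c, d], continuous k}.
  by apply: within_continuous_F_f => // t j; exact: gam01.
have ik : lebesgue_measure.-integrable `[c, d] (EFin \o k).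
  by apply: continuous_compact_integrable => //; exact: segment_compact.
have mk : measurable_fun `]c, d[ k.
  apply: (@measurable_funS _ _ _ _ `[c, d]) => //.
    exact: subset_itv_oo_cc.
  by move/integrableP : ik => [/measurable_EFinP].
have mh : measurable_fun `]c, d[ h.
  by apply: (eq_measurable_fun k) => // t; rewrite inE/= => tcd; rewrite hk.
split; first exact: measurable_fun_itv_cc mh.
rewrite /finsler_length.
rewrite (eq_integral_itv_bounded true false mh mk hk).
pose k' t := f^`()%classic (gamma t 0 i) * g t 0 i.
have cgi := within_continuous_coord (i := i) cgam.
have ck' : {within `[c, d], continuous k'}.
  apply/subspace_continuousP => t tcd.
  have /subspace_continuousP/(_ t tcd) cgit := cgi.
  have /subspace_continuousP/(_ t tcd) cvi := within_continuous_coord (i := i) cg.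
  apply: cvgM cvi.
  exact: (cvg_comp _ _ cgit (cf _ (gam01 t i tcd))).
have ik' : lebesgue_measure.-integrable `[c, d] (EFin \o k').
  by apply: continuous_compact_integrable => //; exact: segment_compact.
have dphi t : t \in `]c, d[ -> is_derive t 1 (f \o (fun t => gamma t 0 i)) (k' t).
  move=> tcd; have dfi : is_derive (gamma t 0 i) 1 f (f^`()%classic (gamma t 0 i)).
    apply: DeriveDef; last by rewrite derive1E.
    by apply: df; apply: gam01; exact: subset_itv_oo_cc.
  have dgi := is_derive_coord i (dgam t tcd).
  exact: is_derive1_comp.
have cphi : {within `[c, d], continuous (f \o (fun t => gamma t 0 i))}.
  apply/subspace_continuousP => t tcd.
  have /subspace_continuousP/(_ t tcd) cgit := cgi.
  have cf0 : {for gamma t 0 i, continuous f}.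
    by apply/differentiable_continuous/derivable1_diffP/df; exact: gam01.
  exact: (cvg_comp _ _ cgit cf0).
have [_ cc cdd] := (continuous_within_itvP _ cd).1 cphi.
rewrite EFinB -(@continuous_FTC2 R k' (f \o (fun t => gamma t 0 i)) c d)//.
- apply: le_integral => // t _; rewrite lee_fin; exact: le_max_family.
- by split => // t /dphi[].
- by move=> t /dphi/derive1_is_derive.
Qed.

(** Induction on the partition: the first piece is split off at [x], lengths add, and the increments
    of [f] telescope. The left endpoint [a] changes at each stage. *)
Lemma piecewise_C1_length_ge (R : realType) (N : nat) (f : R -> R) (b : R)
    (gamma : R -> 'rV[R]_N.+1) i (s : seq R) (a : R) :
  (forall x, x \in `]0, 1[ -> derivable f x 1) ->
  (forall x, x \in `]0, 1[ -> {for x, continuous f^`()%classic}) ->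
  itv_partition a b s ->
  (forall k, (k < size s)%N ->
    C1_on (nth b (a :: s) k) (nth b (a :: s) k.+1) gamma) ->
  {within `[a, b], continuous gamma} ->
  (forall t i, t \in `[a, b] -> gamma t 0 i \in `]0, 1[) ->
  measurable_fun `[a, b] (fun t => F_f f (gamma t) (gamma^`()%classic t)) /\
  ((f (gamma b 0 i) - f (gamma a 0 i))%:E <=
    finsler_length (F_f f) a b gamma)%E.
Proof.
move=> df cf; elim: s a => [a /itv_partition_nil <- _ _ _|x s IH a pas sC1 cgam gam01].
  rewrite /finsler_length set_itv1 integral_set1 subrr; split=> //.
  exact: measurable_fun_set1.
have /andP[ax _] : path <%R a (x :: s) by case: pas.
have /itv_partition_cons pxs := pas.
have xb := itv_partition_le pxs.
have axab : `[a, x] `<=` `[a, b].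
  by apply: subset_itvl; rewrite bnd_simp.
have xbab : `[x, b] `<=` `[a, b].
  by apply: subset_itvr; rewrite bnd_simp ltW.
have [||m1 l1] := C1_on_length_ge i df cf ax (sC1 0%N isT).
- exact: continuous_subspaceW cgam.
- by move=> t j /axab; exact: gam01.
have [|||m2 l2] := IH x pxs.
- by move=> k; exact: (sC1 k.+1).
- exact: continuous_subspaceW cgam.
- by move=> t j /xbab; exact: gam01.
set h := (X in measurable_fun _ X) in m1 m2 *.
(* The second piece is taken half-open so that the two domains are disjoint; closing it again at [x]
   does not change the integral. *)
have m2' : measurable_fun `]x, b] h.
  by apply: measurable_funS m2 => //; exact: subset_itv_oc_cc.
have abE : `[a, b]%classic = `[a, x] `|` `]x, b].
  by apply: itv_bndbnd_setU; rewrite bnd_simp // ltW.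
have m : measurable_fun `[a, b] h by rewrite abE; apply/measurable_funU.
split=> //.
rewrite /finsler_length abE integral_setU//=; last 2 first.
- by rewrite -abE; exact/measurable_EFinP.
- apply/disj_setPRL => t /=; rewrite !in_itv/= => /andP[xt _] /andP[_].
  by rewrite leNgt xt.
rewrite (@integral_itv_obnd_cbnd _ x); last exact/measurable_EFinP.
have -> : f (gamma b 0 i) - f (gamma a 0 i) =
  (f (gamma x 0 i) - f (gamma a 0 i)) + (f (gamma b 0 i) - f (gamma x 0 i)).
  by rewrite [RHS]addrC subrKA.
by rewrite EFinD; exact: leeD.
Qed.

Lemma finsler_dist_ge (R : realType) (N : nat) (f : R -> R)
    (P Q : 'rV[R]_N.+1) :
  (1 <= N)%N ->
  (forall x, x \in `]0, 1[ -> derivable f x 1) ->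
  (forall x, x \in `]0, 1[ -> {for x, continuous f^`()%classic}) ->
  ((D_f f P Q)%:E <= finsler_dist (F_f f) P Q)%E.
Proof.
move=> N1 df cf; apply: le_ereal_inf_tmp => _ [a [b [gamma [cur ->]]]].
have [ab [cgam [s pabs sC1]] gamS <- <-] := cur.
(* The maximum is attained at some index, so the bound for that one coordinate suffices. *)
rewrite /D_f; have [i ->] := max_family_ex (fun i => f (gamma b 0 i) - f (gamma a 0 i)).
have [|_] := piecewise_C1_length_ge i df cf pabs sC1 cgam; last exact.
by move=> t j tab; apply: simplex_int_itv => //; exact: gamS.
Qed.

(** * Upper bound: construction of a curve of length [D_f] *)

(** The path is the inverse of [f] applied to the affine path from [f p] to [f q], and its speed
    comes from the inverse function rule. Since [p] and [q] are interior to the unit interval, the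
    path extends slightly beyond its ends, so the derivative is two-sided even at [t = 0] and
    [t = 1]. *)
Lemma affine_image_path (R : realType) (f : R -> R) (p q : R) :
  {within `[0, 1], continuous f} ->
  {in `[0, 1] &, {homo f : x y / x < y}} ->
  (forall x, x \in `]0, 1[ -> derivable f x 1) ->
  (forall x, x \in `]0, 1[ -> 0 < f^`()%classic x) ->
  p \in `]0, 1[ -> q \in `]0, 1[ -> p <= q ->
  exists c : R -> R, [/\ c 0 = p, c 1 = q,
    forall t : R, t \in `[0, 1] -> p <= c t <= q &
    forall t : R, t \in `[0, 1] ->
      is_derive t 1 c ((f q - f p) / f^`()%classic (c t))].
Proof.
move=> f_cont f_incr df f'_gt0 p01 q01 pq.
have finj : {in `[0, 1] &, injective f}.
  move=> x y x01 y01 fxy; case: (ltgtP x y) => // xy.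
    by have := f_incr _ _ x01 y01 xy; rewrite fxy ltxx.
  by have := f_incr _ _ y01 x01 xy; rewrite fxy ltxx.
(* [g] inverts [f] on its image and takes the default value 0 elsewhere; [img] below shows that
   [y t] is in the image, with a preimage between [p] and [q]. *)
pose g (y : R) : R := xget 0 [set x | x \in `[0, 1] /\ f x = y].
have fK : {in `[0, 1], cancel f g}.
  move=> x x01; rewrite /g; case: xgetP => [z _ [z01 /finj]|/(_ x)]; first exact.
  by case.
have p01' := subset_itv_oo_cc p01; have q01' := subset_itv_oo_cc q01.
have pq01 x : p <= x <= q -> x \in `]0, 1[.
  move=> /andP[px xq]; move: p01 q01; rewrite !in_itv/= => /andP[p0 _] /andP[_ q1].
  by rewrite (lt_le_trans p0 px) (le_lt_trans xq q1).
have fpq : f p <= f q.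
  by move: pq; rewrite le_eqVlt => /predU1P[->//|pq]; exact/ltW/f_incr.
pose y t := f p + t * (f q - f p).
have img t : t \in `[0, 1] -> exists2 x, p <= x <= q & f x = y t.
  rewrite in_itv/= => /andP[t0 t1].
  have [||x] := @IVT R f p q (y t) pq.
  - apply: continuous_subspaceW f_cont => x /=; rewrite in_itv/= => xpq.
    exact/subset_itv_oo_cc/pq01.
  - rewrite min_l// max_r// lerDl mulr_ge0 ?subr_ge0//= /y.
    by rewrite -lerBrDl ler_piMl ?subr_ge0.
  - by rewrite in_itv/= => xpq fx; exists x.
exists (g \o y); split.
- by rewrite /= /y mul0r addr0 fK.
- by rewrite /= /y mul1r addrC subrK fK.
- by move=> t /img[x xpq /= <-]; rewrite fK//; exact/subset_itv_oo_cc/pq01.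
- move=> t /img[x xpq fx]; have x01 := pq01 _ xpq.
  have gx : (g \o y) t = x by rewrite /= -fx fK//; exact: subset_itv_oo_cc.
  rewrite gx.
  have dg : is_derive (y t) 1 g (f^`()%classic x)^-1.
    rewrite -fx; apply: is_derive_inverse.
    + near=> z; apply: fK; apply: subset_itv_oo_cc.
      by near: z; exact: near_in_itvoo.
    + near=> z; apply/differentiable_continuous/derivable1_diffP/df.
      by near: z; exact: near_in_itvoo.
    + by apply: DeriveDef; [exact: df|rewrite derive1E].
    + by rewrite gt_eqF// f'_gt0.
  have dy : is_derive t 1 y (f q - f p).
    apply: is_derive_eq; by rewrite add0r mul1r scaler0 add0r [LHS]mulr1.
  rewrite [X in is_derive _ _ _ X]mulrC; exact: is_derive1_comp.
Unshelve. all: by end_near. Qed.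

Lemma within_continuous_row (R : realType) (n : nat) (A : set R)
    (v : R -> 'rV[R]_n.+1) :
  (forall i, {within A, continuous (fun t => v t 0 i)}) ->
  {within A, continuous v}.
Proof.
move=> cv; apply/subspace_continuousP => t At; apply/cvgrPdist_le => e e0.
near=> s; rewrite /Num.Def.normr/= mx_normrE (bigmax_le _ (ltW e0))//= => -[i j] _.
rewrite ord1 !mxE/=.
move: {i} j; near: s; apply: filter_forall => j.
have /subspace_continuousP/(_ t At) cvi := cv j.
exact: (cvgrPdist_le _ _).1 cvi _ e0.
Unshelve. all: by end_near. Qed.

Lemma is_derive_within_continuous (R : realType) (V : normedModType R)
    (A : set R) (gamma v : R -> V) :
  (forall t : R, A t -> is_derive t 1 gamma (v t)) -> {within A, continuous gamma}.
Proof.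
move=> dg; apply/subspace_continuousP => t /dg[dgt _].
by apply: cvg_within_filter; apply/differentiable_continuous/derivable1_diffP.
Qed.

(** Two-sided differentiability on the closed interval lets the partition with a single piece
    serve. *)
Lemma C1_curve_from_to (R : realType) (N : nat) (P Q : 'rV[R]_N.+1)
    (gamma v : R -> 'rV[R]_N.+1) :
  (forall t : R, t \in `[0, 1] -> is_derive t 1 gamma (v t)) ->
  {within `[0, 1], continuous v} ->
  (forall t : R, t \in `[0, 1] -> simplex_int (gamma t)) ->
  gamma 0 = P -> gamma 1 = Q -> curve_from_to P Q 0 1 gamma.
Proof.
move=> dg cv gS g0 g1; split=> //; split.
  exact: is_derive_within_continuous dg.
exists [:: 1]; first exact: itv_partition1.
move=> [|//] _ /=; exists v; split=> // t tin.
exact/is_derive_C1/dg.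
Qed.

Lemma finsler_dist_le (R : realType) (N : nat) (f : R -> R)
    (P Q : 'rV[R]_N.+1) :
  (1 <= N)%N ->
  {within `[0, 1], continuous f} ->
  {in `[0, 1] &, {homo f : x y / x < y}} ->
  (forall x, x \in `]0, 1[ -> derivable f x 1) ->
  (forall x, x \in `]0, 1[ -> {for x, continuous f^`()%classic}) ->
  (forall x, x \in `]0, 1[ -> 0 < f^`()%classic x) ->
  simplex_int P -> simplex_int Q ->
  (finsler_dist (F_f f) P Q <= (D_f f P Q)%:E)%E.
Proof.
move=> N1 f_cont f_incr df f'_cont f'_gt0 hP hQ.
have P01 i := simplex_int_itv i N1 hP; have Q01 i := simplex_int_itv i N1 hQ.
have P0 i : 0 < P 0 i by case: hP.
have Q0 i : 0 < Q 0 i by case: hQ.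
have sP : \sum_i P 0 i = 1 by case: hP => -[].
have sQ : \sum_i Q 0 i = 1 by case: hQ => -[].
(* c i runs from P_i up to max(P_i, Q_i); the terms G t * (Q_i - U_i), which
   vanish for the growing coordinates, restore the unit sum. When P = Q, M = 0
   and the junk value of G is 0. *)
pose U i := Num.max (P 0 i) (Q 0 i).
have PU i : P 0 i <= U i by rewrite le_max lexx.
have QU i : Q 0 i <= U i by rewrite le_max lexx orbT.
have U01 i : U i \in `]0, 1[ by rewrite /U; case: leP.
have /choice[c cP] i := affine_image_path f_cont f_incr df f'_gt0 (P01 i) (U01 i) (PU i).
have c0 i : c i 0 = P 0 i by case: (cP i).
have c1 i : c i 1 = U i by case: (cP i).
have cb i t : t \in `[0, 1] -> P 0 i <= c i t <= U i by case: (cP i) => _ _ + _; exact.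
pose dc i t := (f (U i) - f (P 0 i)) / f^`()%classic (c i t).
have cd i (t : R) : t \in `[0, 1] -> is_derive t 1 (c i) (dc i t).
  by case: (cP i) => _ _ _; exact.
have c01 i t : t \in `[0, 1] -> c i t \in `]0, 1[.
  move=> /(cb i)/andP[Pc cU]; move: (P01 i) (U01 i).
  rewrite !in_itv/= => /andP[p0 _] /andP[_ u1].
  by rewrite (lt_le_trans p0 Pc) (le_lt_trans cU u1).
pose M := \sum_i (U i - P 0 i).
pose G t := (\sum_i (c i t - P 0 i)) / M.
pose dG t := (\sum_i dc i t) / M.
pose gamma t : 'rV[R]_N.+1 := \row_i (c i t + G t * (Q 0 i - U i)).
pose v t : 'rV[R]_N.+1 := \row_i (dc i t + dG t * (Q 0 i - U i)).
have M0 : 0 <= M by apply: sumr_ge0 => i _; rewrite subr_ge0.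
(* Both points have unit sum, so the total rise [M] of the growing coordinates equals the total fall
   of the others. This is what lets one parameter [G] balance the sum. *)
have ME : M = \sum_i (U i - Q 0 i) by rewrite /M !sumrB sP sQ.
(* Both expressions for [M] are sums of nonnegative terms, so [M = 0] makes all of them vanish. *)
have MU0 : M = 0 -> forall i, U i = P 0 i /\ U i = Q 0 i.
  move=> /[dup] + + i; rewrite {2}ME /M.
  move=> /eqP; rewrite psumr_eq0 => [/allP/(_ i)|j _]; last by rewrite subr_ge0.
  rewrite mem_index_enum subr_eq0 => /(_ isT)/eqP UP.
  move=> /eqP; rewrite psumr_eq0 => [/allP/(_ i)|j _]; last by rewrite subr_ge0.
  by rewrite mem_index_enum subr_eq0 => /(_ isT)/eqP.
(* If [M = 0], each [c i t] is squeezed between equal bounds, so the identity survives the division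
   by zero. *)
have GM t : t \in `[0, 1] -> G t * M = \sum_i (c i t - P 0 i).
  move=> t01; have [M_0|M_0] := eqVneq M 0; last by rewrite divfK.
  rewrite M_0 mulr0 big1// => i _; have /andP[Pc] := cb i t t01.
  by rewrite (MU0 M_0 i).1 => cP'; apply/eqP; rewrite subr_eq0 eq_le cP' Pc.
have G01 t : t \in `[0, 1] -> 0 <= G t <= 1.
  move=> t01; apply/andP; split.
    rewrite divr_ge0// sumr_ge0// => i _; rewrite subr_ge0.
    by case/andP: (cb i t t01).
  rewrite /G; have [->|M_0] := eqVneq M 0; first by rewrite invr0 mulr0.
  rewrite ler_pdivrMr ?lt_def ?M_0// mul1r; apply: ler_sum => i _.
  by rewrite lerB//; case/andP: (cb i t t01).
have cPi i t : t \in `[0, 1] -> Q 0 i < P 0 i -> c i t = P 0 i.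
  move=> t01 QP; have := cb i t t01; rewrite /U (max_l (ltW QP)) => PP.
  by apply/eqP; rewrite eq_le andbC.
(* A growing coordinate is just [c i t]; a falling one is [P 0 i + G t * (Q 0 i - P 0 i)], which
   stays above [Q 0 i] because [G t <= 1]. *)
have gam0 i t : t \in `[0, 1] -> 0 < gamma t 0 i.
  move=> t01; rewrite mxE; have [PQ|QP] := leP (P 0 i) (Q 0 i).
    rewrite /U max_r// subrr mulr0 addr0.
    by have := c01 i t t01; rewrite in_itv/= => /andP[].
  rewrite cPi// /U (max_l (ltW QP)); have /andP[G0 G1] := G01 t t01.
  apply: (lt_le_trans (Q0 i)); rewrite -lerBlDl -[leLHS]mul1r.
  by rewrite ler_wnM2r// subr_le0 ltW.
have sgam t : t \in `[0, 1] -> \sum_i gamma t 0 i = 1.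
  move=> t01; under eq_bigr do rewrite mxE.
  rewrite big_split/= -mulr_sumr.
  have -> : \sum_i (Q 0 i - U i) = - M.
    by rewrite ME -sumrN; apply: eq_bigr => i _; rewrite opprB.
  by rewrite mulrN GM// sumrB sP opprB addrC subrK.
have gamS t : t \in `[0, 1] -> simplex_int (gamma t).
  move=> t01; split; last by move=> i; exact: gam0.
  split; last exact: sgam.
  (* The upper bound 1 follows from the unit sum and the positivity of the other coordinates. *)
  move=> i; rewrite ltW ?gam0//= -(sgam t t01) (bigD1 i)//= lerDl sumr_ge0// => j _.
  exact/ltW/gam0.
have dcc i : {within `[0, 1], continuous (dc i)}.
  apply/subspace_continuousP => t t01.
  have /subspace_continuousP/(_ t t01) ci :=
    is_derive_within_continuous (fun t (t01 : `[0, 1]%classic t) => cd i t t01).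
  apply: cvgM; first exact: cvg_cst.
  apply: cvgV; first by rewrite gt_eqF// f'_gt0// c01.
  exact: (cvg_comp _ _ ci (f'_cont _ (c01 i t t01))).
have cdG : {within `[0, 1], continuous dG}.
  apply/subspace_continuousP => t t01; apply: cvgM; last exact: cvg_cst.
  apply: cvg_big; first exact: add_continuous.
  by move=> i _; have /subspace_continuousP/(_ t t01) := dcc i.
have cv : {within `[0, 1], continuous v}.
  apply: within_continuous_row => i.
  have -> : (fun t => v t 0 i) = (fun t => dc i t + dG t * (Q 0 i - U i)).
    by apply/funext => t; rewrite mxE.
  apply/subspace_continuousP => t t01.
  apply: cvgD; first by have /subspace_continuousP/(_ t t01) := dcc i.
  apply: cvgM; last exact: cvg_cst.
  by have /subspace_continuousP/(_ t t01) := cdG.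
have dgam (t : R) : t \in `[0, 1] -> is_derive t 1 gamma (v t).
  move=> t01; apply: is_derive_row => i; rewrite mxE.
  have -> : (fun t => gamma t 0 i) = (fun t => c i t + G t * (Q 0 i - U i)).
    by apply/funext => s; rewrite mxE.
  have dGt : is_derive t 1 G (dG t).
    have dS : is_derive t 1 (fun t => \sum_i (c i t - P 0 i)) (\sum_i dc i t).
      have dj j : is_derive t 1 (fun t => c j t - P 0 j) (dc j t).
        have := cd j t t01 => dcj.
        by apply: is_derive_eq; rewrite oppr0 addr0.
      have -> : (fun t => \sum_i (c i t - P 0 i)) = \sum_i (fun t => c i t - P 0 i).
        by apply/funext => s; rewrite fct_sumE.
      exact: is_derive_sum.
    by apply: is_derive_eq; rewrite scaler0 add0r [LHS]mulrC.
  have := cd i t t01 => dci.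
  by apply: is_derive_eq; rewrite scaler0 add0r; congr (_ + _); rewrite [LHS]mulrC.
have FE t : t \in `[0, 1] -> F_f f (gamma t) (gamma^`()%classic t) = D_f f P Q.
  move=> t01; rewrite (derive1_is_derive (dgam t t01)).
  have f'0 i : 0 < f^`()%classic (c i t) by apply/f'_gt0/c01.
  have fPU i : f (P 0 i) <= f (U i).
    have := PU i; rewrite le_eqVlt => /predU1P[->//|PUi].
    by apply/ltW/f_incr => //; exact: subset_itv_oo_cc.
  have dG0 : 0 <= dG t.
    by rewrite divr_ge0// sumr_ge0// => i _; rewrite divr_ge0 ?subr_ge0// ltW.
  (* Here [U i = Q 0 i], so the correction vanishes and the factor [f'] cancels the denominator of
     [dc]. *)
  have FA i : P 0 i <= Q 0 i ->
      f^`()%classic (gamma t 0 i) * v t 0 i = f (Q 0 i) - f (P 0 i).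
    move=> PQ; rewrite !mxE /dc /U max_r// subrr !mulr0 !addr0.
    by rewrite mulrC divfK// gt_eqF.
  (* Here [U i = P 0 i], so [dc] vanishes and only [dG t >= 0] times a negative number is left. *)
  have FB i : Q 0 i < P 0 i -> f^`()%classic (gamma t 0 i) * v t 0 i <= 0.
    move=> QP; rewrite mulr_ge0_le0//.
      by apply/ltW/f'_gt0/(simplex_int_itv i N1)/gamS.
    rewrite mxE /dc /U (max_l (ltW QP)) subrr mul0r add0r mulr_ge0_le0//.
    by rewrite subr_le0 ltW.
  have [i0 DE] := max_family_ex (fun i => f (Q 0 i) - f (P 0 i)).
  (* Two vectors of equal sum cannot satisfy [Q 0 i < P 0 i] at every index. Nonnegativity of [D_f]
     then absorbs the falling terms in the maximum. *)
  have D0 : 0 <= D_f f P Q.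
    have [i PQ] : exists i, P 0 i <= Q 0 i.
      apply/not_existsP => H.
      have : \sum_i Q 0 i < \sum_i P 0 i.
        apply: ltr_sum => [|i _]; first by apply/hasP; exists ord0.
        by rewrite ltNge; apply/negP/H.
      by rewrite sP sQ ltxx.
    apply: le_trans (le_max_family _ i); rewrite subr_ge0.
    by have := fPU i; rewrite /U max_r.
  apply/eqP; rewrite eq_le; apply/andP; split.
    apply: max_family_le => i; have [PQ|QP] := leP (P 0 i) (Q 0 i).
      rewrite FA//; exact: (le_max_family (fun i => f (Q 0 i) - f (P 0 i))).
    exact: le_trans (FB i QP) D0.
  (* The index attaining [D_f] must be a growing one, since [f] is strictly increasing and a falling
     index would make [D_f] negative; hence [FA] applies to it. *)
  have PQ0 : P 0 i0 <= Q 0 i0.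
    rewrite leNgt; apply/negP => QP; move: D0; rewrite /D_f DE leNgt subr_lt0.
    by rewrite f_incr//; exact: subset_itv_oo_cc.
  rewrite {1}/D_f DE -FA//.
  exact: (le_max_family (fun i => f^`()%classic (gamma t 0 i) * v t 0 i)).
have cur : curve_from_to P Q 0 1 gamma.
  apply: (C1_curve_from_to dgam cv gamS); apply/rowP => i; rewrite mxE.
    by rewrite c0 /G big1 ?mul0r ?addr0// => j _; rewrite c0 subrr.
  rewrite c1 /G; under eq_bigr do rewrite c1; rewrite -/M.
  (* Normally [G 1 = 1]; for [M = 0] the default [G 1 = 0] is harmless, as [U i = Q 0 i]. *)
  have [M_0|M_0] := eqVneq M 0; last by rewrite divff// mul1r addrC subrK.
  by rewrite -(MU0 M_0 i).2 subrr mulr0 addr0.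
suff <- : finsler_length (F_f f) 0 1 gamma = (D_f f P Q)%:E.
  by apply: ereal_inf_lbound; exists 0, 1, gamma; split; first exact: cur.
(* The integrand is constant on an interval of length 1. *)
rewrite /finsler_length (eq_integral (cst (D_f f P Q)%:E)); last first.
  by move=> t; rewrite inE/= => t01; rewrite FE.
rewrite integral_cst//= lebesgue_measure_itv/= lte_fin ltr01.
by rewrite oppr0 adde0 mule1.
Qed.

Theorem corollary3p7 (R : realType) (N : nat) (f : R -> R)
  (N_ge1 : (1 <= N)%N)
  (f_cont : {within `[0, 1], continuous f})
  (f_incr : {in `[0, 1] &, {homo f : x y / x < y}})
  (f_derivable : forall x, x \in `]0, 1[ -> derivable f x 1)
  (f'_cont : forall x, x \in `]0, 1[ -> {for x, continuous f^`()%classic})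
  (f'_gt0 : forall x, x \in `]0, 1[ -> 0 < f^`()%classic x)
  (P Q : 'rV[R]_N.+1) (hP : simplex_int P) (hQ : simplex_int Q) :
  (D_f f P Q)%:E = finsler_dist (F_f f) P Q.
Proof.
by apply/eqP; rewrite eq_le finsler_dist_ge ?finsler_dist_le.
Qed.
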